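(* Let $(V,\{\,,\,,\,\},\langle\,,\,\rangle,(\,,\,))$ be a finite dimensional $3D$-fluid algebra with curl operator $D$ and transport $T$. If $X(t)\in V$ satisfies the Euler equation of the fluid algebra, i.e. $\left(\frac{dX(t)}{dt},Z\right)=\{X(t),DX(t),Z\}$ for all $Z\in V$, then the vorticity $Y(t)=DX(t)$ satisfies $$\frac{dY(t)}{dt}=T(X(t),Y(t)).$$
   Context: A finite dimensional $3D$-fluid algebra is a finite dimensional real vector space $V$ with three structures: (1) an alternating trilinear form $\{\,,\,,\,\}$ on $V$ (triple intersection form); (2) a symmetric nondegenerate bilinear form $\langle\,,\,\rangle$ on $V$ (vorticity linking form); (3) a positive definite inner product $(\,,\,)$ on $V$ (metric). The curl operator $D:V\to V$ is the linear operator defined by $(DX,Y)=\langle X,Y\rangle$ for all $X,Y\in V$. The vorticity of $X\in V$ is $DX$. The infinitesimal transport of $Z$ by $X$ is the element $T(X,Z)\in V$ defined by $(T(X,Z),W)=\{X,Z,DW\}$ for all $W\in V$. *)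

(* Defs.v *)
From HB Require Import structures.
From mathcomp Require Import all_boot all_order all_algebra.
From mathcomp Require Import all_classical all_reals all_analysis.

Set Implicit Arguments.
Unset Strict Implicit.
Unset Printing Implicit Defensive.

Import Order.TTheory GRing.Theory Num.Theory.
Import numFieldNormedType.Exports.

Local Open Scope ring_scope.

Definition trilinear (R : realType) (V : vectType R) (f : V -> V -> V -> R) :=
  [/\ forall y z, scalar (fun x => f x y z),
      forall x z, scalar (fun y => f x y z) &
      forall x y, scalar (fun z => f x y z)].

Definition alternating (R : realType) (V : vectType R)
    (f : V -> V -> V -> R) :=
  [/\ forall x z, f x x z = 0,
      forall x y, f x y y = 0 &
      forall x y, f x y x = 0].

Record fluid_algebra (R : realType) (V : vectType R) := FluidAlgebra {
  triple : V -> V -> V -> R;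
  linking : {symmetric V};
  metric : {dot V for idfun};
  triple_trilinear : trilinear triple;
  triple_alternating : alternating triple;
  linking_nondegenerate : nondegenerate linking
}.

Section FluidAlgebra.
Variables (R : realType) (V : vectType R) (F : fluid_algebra V).

Lemma metric_sym x y : metric F x y = metric F y x.
Proof. by rewrite hermC /= expr0 mul1r. Qed.

Lemma metric_inj x y : (forall z, metric F x z = metric F y z) -> x = y.
Proof.
move=> h; apply/eqP; rewrite -subr_eq0; apply/negPn/negP => xy.
have : 0 < metric F (x - y) (x - y) by exact: neq0_dnorm_gt0.
by rewrite linearBl /= h subrr ltxx.
Qed.

Let flat (x : V) : 'Hom(V, R^o) := linfun (metric F x : V -> R^o).

Let flatE x y : flat x y = metric F x y.
Proof. by rewrite lfunE. Qed.

Let flat_linear : linear flat.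
Proof.
move=> a x y; apply/lfunP => z.
by rewrite add_lfunE scale_lfunE !flatE linearDl linearZl_LR.
Qed.

Lemma riesz_ex (phi : V -> R) :
  scalar phi -> exists x, forall y, metric F x y = phi y.
Proof.
move=> phiL.
pose Phi := HB.pack_for {linear V -> R^o} (phi : V -> R^o)
  (GRing.isLinear.Build R V R^o _ (phi : V -> R^o) phiL).
pose Flat := HB.pack_for {linear V -> 'Hom(V, R^o)} flat
  (GRing.isLinear.Build R V 'Hom(V, R^o) _ flat flat_linear).
have ker0 : lker (linfun Flat) == 0%VS.
  apply/lker0P => x y; rewrite !lfunE /= => e.
  by apply: metric_inj => z; rewrite -!flatE e.
have : linfun Phi \in limg (linfun Flat).
  suff -> : limg (linfun Flat) = fullv by rewrite memvf.
  apply/eqP; rewrite eqEdim subvf /= limg_dim_eq; last first.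
    by rewrite (eqP ker0) capv0.
  by rewrite !dimvf /dim /= muln1.
case/memv_imgP => x _ e; exists x => y.
by rewrite -flatE; move/lfunP: e => /(_ y); rewrite !lfunE /= => <-.
Qed.

(* Meaningful when phi is linear, see rieszE; the default value 0 is never used
   below. *)
Definition riesz (phi : V -> R) : V :=
  xget 0 [set x | forall y, metric F x y = phi y]%classic.

Lemma rieszE phi : scalar phi -> forall y, metric F (riesz phi) y = phi y.
Proof. by move=> /riesz_ex h; exact: (xgetPex 0 h). Qed.

Definition curl (x : V) : V := riesz (linking F x).

Lemma curlE x y : metric F (curl x) y = linking F x y.
Proof. by apply: rieszE => a u v; exact: linearPr. Qed.

Fact curl_linear : linear curl.
Proof.
move=> a x y; apply: metric_inj => z.
by rewrite curlE !linearDl !linearZl_LR /= !curlE.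
Qed.

HB.instance Definition _ := GRing.isLinear.Build R V V _ curl curl_linear.

Definition transport (x z : V) : V := riesz (fun w => triple F x z (curl w)).

Lemma transportE x z w : metric F (transport x z) w = triple F x z (curl w).
Proof.
have [_ _ h] := triple_trilinear F.
apply: (@rieszE (fun w => triple F x z (curl w))) => a u v.
by rewrite linearP h.
Qed.

End FluidAlgebra.

(* A vectType carries no topology: the derivative of a curve is taken in the
   normed space of coordinate row vectors. The choice of basis is immaterial,
   a change of basis being a linear, hence continuous, isomorphism. *)
Definition is_velocity (R : realType) (V : vectType R)
    (X : R -> V) (t : R) (v : V) : Prop :=
  is_derive t 1 (fun s => passmx.rVof (vbasis fullv) (X s))
    (passmx.rVof (vbasis fullv) v).

Definition euler_solution (R : realType) (V : vectType R)
    (F : fluid_algebra V) (I : set R) (X : R -> V) : Prop :=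
  forall t, I t -> exists2 dX : V, is_velocity X t dX &
    forall Z, metric F dX Z = triple F (X t) (curl F (X t)) Z.

(* Main.v *)
(* The curl is constant in time, so d(DX)/dt = D(dX/dt). Since the linking form
   is symmetric, D is self-adjoint for the metric, and for every W
   (D(dX/dt), W) = (dX/dt, DW) = {X, DX, DW} = (T(X, DX), W). *)
Require Import Defs.
From mathcomp Require Import all_boot all_order all_algebra.
From mathcomp Require Import all_classical all_reals all_analysis.

Import numFieldNormedType.Exports.

Import GRing.Theory.
Local Open Scope ring_scope.

Lemma is_derive_coord (R : realFieldType) (U : normedModType R) (m n : nat)
    (f : U -> 'M[R]_(m, n)) (x v : U) (df : 'M[R]_(m, n)) i j :
  is_derive x v f df -> is_derive x v (fun y => f y i j) (df i j).
Proof.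
move=> [fD <-]; apply: DeriveDef; first exact: (derivable_mxP _ _ _).1.
by rewrite derive_mx// mxE.
Qed.

Lemma is_derive_mx (R : realFieldType) (U : normedModType R) (m n : nat)
    (f : U -> 'M[R]_(m, n)) (x v : U) (df : 'M[R]_(m, n)) :
  (forall i j, is_derive x v (fun y => f y i j) (df i j)) ->
  is_derive x v f df.
Proof.
move=> fD; have fd : derivable f x v by apply/derivable_mxP => i j.
apply: DeriveDef => //; rewrite derive_mx//; apply/matrixP => i j.
by rewrite mxE derive_val.
Qed.

(** Each entry of the product is a combination, with constant coefficients from [A], of entries of
    [f], so the sum and scaling rules suffice. *)
Lemma is_derive_mulmxr (R : realFieldType) (U : normedModType R) (m n p : nat)
    (f : U -> 'M[R]_(m, n)) (x v : U) (df : 'M[R]_(m, n)) (A : 'M[R]_(n, p)) :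
  is_derive x v f df -> is_derive x v (fun y => f y *m A) (df *m A).
Proof.
move=> fD; apply: is_derive_mx => i j.
(* The constant factor moves to the left, turning the entry into a sum of scalar multiples of
   functions. *)
have -> : (fun y => (f y *m A) i j) = \sum_k (A k j \*: (fun y => f y i k)).
  apply/funext => y; rewrite mxE fct_sumE; apply: eq_bigr => k _.
  by rewrite mulrC.
have -> : (df *m A) i j = \sum_k A k j *: df i k.
  by rewrite mxE; apply: eq_bigr => k _; rewrite mulrC.
by apply: is_derive_sum => k; apply/is_deriveZ/is_derive_coord.
Qed.

(** In coordinates [phi] is right multiplication by a matrix independent of time, so it commutes
    with differentiation. *)
Lemma is_velocity_lfun (R : realType) (V : vectType R) (phi : 'End(V))
    (X : R -> V) (t : R) (v : V) :
  is_velocity X t v -> is_velocity (fun s => phi (X s)) t (phi v).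
Proof.
have rVof_phi := passmx.rVof_app (vbasis {:V}) (vbasisP {:V}) phi.
rewrite /is_velocity rVof_phi => XD.
by under eq_fun do rewrite rVof_phi; exact: is_derive_mulmxr.
Qed.

Section SelfAdjoint.
Variables (R : realType) (V : vectType R) (F : fluid_algebra V).

Lemma curl_selfadjoint x y : metric F (curl F x) y = metric F x (curl F y).
(* [hermC] swaps the arguments of the linking form, [metric_sym] those of the metric; both sides
   become [linking F y x]. *)
Proof. by rewrite curlE hermC /= expr0 mul1r Defs.metric_sym curlE. Qed.

Lemma is_velocity_curl (X : R -> V) (t : R) (v : V) :
  is_velocity X t v -> is_velocity (fun s => curl F (X s)) t (curl F v).
Proof.
have curl_lfun x : curl F x = linfun (curl F) x by rewrite lfunE.
rewrite curl_lfun => XD.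
by under eq_fun do rewrite curl_lfun; exact: is_velocity_lfun.
Qed.

End SelfAdjoint.

Theorem corollary1p7 (R : realType) (V : vectType R) (F : fluid_algebra V)
    (I : set R) (openI : open I) (X : R -> V) (eulerX : euler_solution F I X)
    (t : R) (It : I t) :
  is_velocity (fun s => curl F (X s)) t (transport F (X t) (curl F (X t))).
Proof.
have [dX XdX dXE] := eulerX t It.
(* What remains is an identity between two vectors at the fixed time [t], checked by pairing with
   every [W]. *)
suff -> : transport F (X t) (curl F (X t)) = curl F dX.
  exact: is_velocity_curl.
apply: (metric_inj (F := F)) => W.
(* The Euler equation [dXE] is used with test vector [Z = curl F W]. *)
by rewrite transportE curl_selfadjoint dXE.
Qed.
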